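(* Let $n,k$ be positive integers with $n>48k$, and let $\mathcal F\subset\binom{[n]}{k}$ be intersecting. Then $$\gamma(\mathcal F)\le \binom{n-3}{k-2}.$$
   Context: $[n]=\{1,\dots,n\}$ and $\binom{[n]}{k}$ is the set of $k$-element subsets of $[n]$. A family $\mathcal F$ is intersecting if $F\cap F'\neq\emptyset$ for all $F,F'\in\mathcal F$. For $i\in[n]$, $\mathcal F(\bar i)=\{F\in\mathcal F: i\notin F\}$. The diversity is $\gamma(\mathcal F)=\min_{i\in[n]}|\mathcal F(\bar i)|$. *)

(* Defs.v *)
From mathcomp Require Import all_boot all_order.
Set Implicit Arguments. Unset Strict Implicit. Unset Printing Implicit Defensive.

Definition k_uniform n k (FF : {set {set 'I_n}}) : bool :=
  [forall F in FF, #|F| == k].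

Definition intersecting n (FF : {set {set 'I_n}}) : bool :=
  [forall F in FF, forall G in FF, F :&: G != set0].

Definition avoid n (FF : {set {set 'I_n}}) (i : 'I_n) : {set {set 'I_n}} :=
  [set F in FF | i \notin F].

(* diversity gamma(FF) = min_i |FF(bar i)|.  Each |FF(bar i)| <= |FF|, so
   seeding the min with |FF| gives exactly the minimum when n > 0. *)
Definition diversity n (FF : {set {set 'I_n}}) : nat :=
  \big[minn/#|FF|]_(i < n) #|avoid FF i|.

(* binomial with integer lower index b - 2, using C(m, -1) = 0 *)
Definition binom_sub2 (m b : nat) : nat := if b < 2 then 0 else 'C(m, b - 2).

(* Main.v *)
Require Import Defs.
From mathcomp Require Import all_boot all_order.
From mathcomp Require Import fingroup perm zify.
Set Implicit Arguments.
Unset Strict Implicit.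
Unset Printing Implicit Defensive.

(** Write [M = 'C(n - 3, k - 2)] and [D = 'C(n - 3, n - k)]; the latter is [C(n-3, k-3)], with
    the correct value [0] for [k = 2], and [47 * D <= M].  By Kruskal-Katona, if more than [3 * D]
    members of an intersecting family contain a pair, then at most [D] members miss it.

    Call a family scattered if no pair lies in more than [4 * D] members and every point is missed
    by more than [14 * D] members.  A shift [j -> i] of a large scattered family is again
    scattered unless one of [i], [j] is missed by at most [19 * D] members, and at most one point
    [x] can be so.  Shifting outside [x] towards two points [p], [q] therefore never gets stuck,
    and at the end the members missing [x], [p], [q] pairwise meet in 3 points, so there are at
    most [D] of them; but at most [D] members missing a triple is impossible in a scattered
    family.  Hence a family of diversity above [M] has a pair in more than [4 * D] members, which
    forces a triple such that each of its three pairs is missing at most [3 * D] of the [M]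
    possible members meeting the triple in exactly that pair.  Kruskal-Katona then bounds every
    other kind of member by a quarter of this deficit, and summing over the three pairs
    contradicts the diversity. *)

(** * Shifting *)

Section Shift.

Variable T : finType.
Implicit Types (A B C : {set {set T}}) (F G H : {set T}) (i j x : T).

Definition swap i j F : {set T} := [set x | tperm i j x \in F].

Lemma in_swap i j F x : (x \in swap i j F) = (tperm i j x \in F).
Proof. by rewrite inE. Qed.

Lemma swapK i j : involutive (swap i j).
Proof. by move=> F; apply/setP=> x; rewrite !in_swap tpermK. Qed.

Lemma swapI i j F G : swap i j (F :&: G) = swap i j F :&: swap i j G.
Proof. by apply/setP=> x; rewrite !(in_swap, inE). Qed.

Lemma swap_id i j F : (i \in F) = (j \in F) -> swap i j F = F.
Proof.
by move=> eF; apply/setP=> x; rewrite in_swap; case: tpermP => [-> | -> |].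
Qed.

Lemma card_swap i j F : #|swap i j F| = #|F|.
Proof.
rewrite -[RHS](card_imset _ (@perm_inj _ (tperm i j))); apply: eq_card => x.
rewrite in_swap; apply/idP/imsetP => [Fx | [y Fy ->]]; last by rewrite tpermK.
by exists (tperm i j x) => //; rewrite tpermK.
Qed.

Lemma swapS i j F G : F \subset G -> swap i j F \subset swap i j G.
Proof. by move=> /subsetP sFG; apply/subsetP=> x; rewrite !in_swap => /sFG. Qed.

Definition shift1 i j A F :=
  if [&& j \in F, i \notin F & swap i j F \notin A] then swap i j F else F.

Definition shift i j A := shift1 i j A @: A.

Lemma shift1_inj i j A : {in A &, injective (shift1 i j A)}.
Proof.
move=> F G AF AG; rewrite /shift1.
case: ifP => [/and3P[jF iF sF] | _]; case: ifP => [/and3P[jG iG sG] | _] //.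
- exact: (inv_inj (@swapK i j)).
- by move=> eFG; rewrite eFG AG in sF.
- by move=> eFG; rewrite -eFG AF in sG.
Qed.

Lemma card_shift i j A : #|shift i j A| = #|A|.
Proof. exact: card_in_imset (@shift1_inj i j A). Qed.

Lemma in_shift i j A H : (H \in shift i j A) =
  if (i \in H) && (j \notin H) then (H \in A) || (swap i j H \in A)
  else if (j \in H) && (i \notin H) then (H \in A) && (swap i j H \in A)
  else H \in A.
Proof.
have si F : (i \in swap i j F) = (j \in F) by rewrite in_swap tpermL.
have sj F : (j \in swap i j F) = (i \in F) by rewrite in_swap tpermR.
apply/imsetP/idP => [[F AF ->] | ].
  rewrite /shift1; case: (boolP [&& _, _ & _]) => [/and3P[jF iF sF] | ].
    by rewrite si sj jF iF /= swapK AF orbT.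
  by rewrite AF; case: (i \in F); case: (j \in F) => //=; rewrite ?negbK.
case: ifP => [/andP[iH jH] | _].
  have [AH _ | /= nAH AsH] := boolP (H \in A).
    by exists H => //; rewrite /shift1 (negPf jH).
  by exists (swap i j H) => //; rewrite /shift1 si sj iH jH swapK nAH.
case: ifP => [/andP[jH iH] /andP[AH AsH] | ne AH].
  by exists H => //; rewrite /shift1 AsH /= !andbF.
by exists H => //; rewrite /shift1 andbA ne.
Qed.

Lemma shift_sub i j A H : H \in shift i j A -> (H \in A) || (swap i j H \in A).
Proof.
by rewrite in_shift; case: ifP => // _; case: ifP => [_ /andP[->] | _ ->].
Qed.

Lemma shift_in i j A H : j \in H -> H \in shift i j A -> H \in A.
Proof. by move=> jH; rewrite in_shift jH andbF /=; case: ifP => // _ /andP[]. Qed.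

Lemma in_shift_notin i j A F : j \notin F -> F \in A -> F \in shift i j A.
Proof. by move=> jF AF; rewrite in_shift jF AF (negPf jF); case: ifP. Qed.

Lemma shift_fixed i j A F : shift i j A = A -> F \in A ->
  j \in F -> i \notin F -> swap i j F \in A.
Proof.
move=> eA AF jF iF; apply/negPn/negP => nA.
case/negP: (nA); rewrite -eA; apply/imsetP; exists F => //.
by rewrite /shift1 jF iF nA.
Qed.

Definition uniform a A := {in A, forall F, #|F| = a}.

Lemma shift_uniform i j a A : uniform a A -> uniform a (shift i j A).
Proof.
by move=> uA F /shift_sub/orP[] /uA // <-; rewrite card_swap.
Qed.

Definition cross t A B := {in A & B, forall F G, t <= #|F :&: G|}.

Lemma leq_card_swapI i j F G : j \notin F -> i \in G ->
  #|F :&: swap i j G| <= #|F :&: G|.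
Proof.
move=> jF iG; apply/subset_leq_card/subsetP=> x; rewrite !inE => /andP[xF].
by rewrite xF; case: tpermP xF => [-> | -> jF' | ] //; rewrite jF' in jF.
Qed.

Lemma cross_sym t A B : cross t A B -> cross t B A.
Proof. by move=> cAB F G BF AG; rewrite setIC; apply: cAB. Qed.

(** A new member [H] comes from the old member [swap i j H]. If [swap i j K] is an old member too,
    swap both sets; otherwise [K] contains [i] but not [j], and it meets [H] in at least as many
    points as it meets [swap i j H]. *)
Lemma shift_cross i j t A B : cross t A B -> cross t (shift i j A) (shift i j B).
Proof.
have half A' B' H K : cross t A' B' -> H \in shift i j A' -> H \notin A' ->
    K \in shift i j B' -> t <= #|H :&: K|.
  move=> cAB sH nH sK.
  have AsH : swap i j H \in A' by have := shift_sub sH; rewrite (negPf nH).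
  have [iH jH] : i \in H /\ j \notin H.
    move: sH; rewrite in_shift (negPf nH) /=.
    by case: ifP => [/andP[]|_] //; rewrite if_same.
  have [BsK | nK] := boolP (swap i j K \in B').
    by rewrite -(card_swap i j) swapI; apply: cAB.
  have BK : K \in B' by have := shift_sub sK; rewrite (negPf nK) orbF.
  have [iK jK] : i \in K /\ j \notin K.
    move: sK; rewrite in_shift (negPf nK) BK /=.
    have [iK|iK] := boolP (i \in K); have [jK|jK] := boolP (j \in K) => //= _.
      by rewrite swap_id ?BK ?iK ?jK // in nK.
    by rewrite swap_id ?BK ?(negPf iK) ?(negPf jK) // in nK.
  rewrite setIC; apply: leq_trans (leq_card_swapI jK iH).

  by rewrite setIC; apply: cAB.
move=> cAB H K sH sK.
have [AH | nH] := boolP (H \in A); last exact: (half A B).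
have [BK | nK] := boolP (K \in B); first exact: cAB.
by rewrite setIC; apply: (half B A) => //; apply: cross_sym.
Qed.

(** Termination measure for shifts from points of [Q] to points outside [Q]. *)
Definition weight (Q : {set T}) A := \sum_(F in A) #|F :&: Q|.

Lemma weight_shift (Q : {set T}) i j A : i \notin Q -> j \in Q ->
  shift i j A != A -> weight Q (shift i j A) < weight Q A.
Proof.
move=> iQ jQ nfix; rewrite /weight big_imset; last exact: shift1_inj.
have moved F : shift1 i j A F != F -> #|shift1 i j A F :&: Q| < #|F :&: Q|.
  rewrite /shift1; case: ifP => [/and3P[jF iF _] _ | _ /eqP //].
  apply: proper_card; apply/properP; split.
    apply/subsetP=> x; rewrite !inE => /andP[xF xQ]; rewrite xQ andbT.
    by case: tpermP xF xQ => [-> _ | -> | //]; rewrite ?(negPf iQ).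
  by exists j; rewrite !inE ?jF ?tpermR ?(negPf iF).
have [F AF nF] : exists2 F, F \in A & shift1 i j A F != F.
  apply/exists_inP; apply: contraNT nfix; rewrite negb_exists_in => /forall_inP fx.
  by apply/eqP; rewrite -[RHS]imset_id; apply: eq_in_imset => F /fx /negPn/eqP.
rewrite (bigD1 F) //= [X in _ < X](bigD1 F) //= -addSn leq_add ?moved //.
apply: leq_sum => G _; have [-> // | /moved] := eqVneq (shift1 i j A G) G.
exact: ltnW.
Qed.

(** Shift until nothing moves; the total weight drops each time. Two families are carried along
    because cross conditions survive only when both are shifted together; a single family is handled
    by putting equality into [Pr]. *)
Lemma compress (Pr : {set {set T}} -> {set {set T}} -> Prop) (R Q : {set T}) :
  [disjoint R & Q] ->
  (forall i j A B, i \in R -> j \in Q -> Pr A B -> Pr (shift i j A) (shift i j B)) ->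
  forall A B, Pr A B -> exists A' B', [/\ Pr A' B',
    {in R & Q, forall i j, shift i j A' = A'} & {in R & Q, forall i j, shift i j B' = B'}].
Proof.
move=> dRQ PrS A B; have [m] := ubnP (weight Q A + weight Q B).
elim: m => // m IH in A B * => ltm PrAB.
have [/exists_inP[i iR /exists_inP[j jQ nfix]] | ] := boolP [exists i in R,
    [exists j in Q, (shift i j A != A) || (shift i j B != B)]]; last first.
  rewrite negb_exists_in => /forall_inP fx; exists A, B; split=> // i j /fx.
    by rewrite negb_exists_in => /forall_inP fxi /fxi; rewrite negb_or => /andP[/negPn/eqP].
  by rewrite negb_exists_in => /forall_inP fxi /fxi; rewrite negb_or => /andP[_ /negPn/eqP].
have iQ : i \notin Q by rewrite (disjointFr dRQ iR).
have leW (C : {set {set T}}) : weight Q (shift i j C) <= weight Q C.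
  have [-> // | /(weight_shift iQ jQ)] := eqVneq (shift i j C) C.
  exact: ltnW.
apply: (IH (shift i j A) (shift i j B)); last exact: PrS.
have := leW A; have := leW B.
by case/orP: nfix => /(weight_shift iQ jQ); lia.
Qed.

(** * Counting members by points contained and points avoided *)

Definition sel A (s r : seq T) : {set {set T}} :=
  [set F in A | all (fun x => x \in F) s && all (fun x => x \notin F) r].

Lemma in_sel A s r F : (F \in sel A s r) =
  [&& F \in A, all (fun x => x \in F) s & all (fun x => x \notin F) r].
Proof. by rewrite inE. Qed.

Definition num A s r := #|sel A s r|.

Lemma num_split A s r x : num A s r = num A (x :: s) r + num A s (x :: r).
Proof.
rewrite /num.
rewrite -(cardsID [set F : {set T} | x \in F] (sel A s r)); congr (_ + _).
  by apply: eq_card => F; rewrite !inE /=;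
    case: (F \in A) (x \in F) (all _ s) (all _ r) => [] [] [] [].
by apply: eq_card => F; rewrite !inE /=;
    case: (F \in A) (x \in F) (all _ s) (all _ r) => [] [] [] [].
Qed.

Lemma sel_subset A s r s' r' : {subset s <= s'} -> {subset r <= r'} ->
  sel A s' r' \subset sel A s r.
Proof.
move=> ss rr; apply/subsetP=> F; rewrite !in_sel => /and3P[-> /allP sF /allP rF] /=.
by apply/andP; split; apply/allP=> x; [move=> /ss/sF | move=> /rr/rF].
Qed.

Lemma leq_num A s r s' r' : {subset s <= s'} -> {subset r <= r'} ->
  num A s' r' <= num A s r.
Proof. by move=> ss rr; apply/subset_leq_card/sel_subset. Qed.

Lemma eq_num A s r s' r' : s =i s' -> r =i r' -> num A s r = num A s' r'.
Proof. by move=> ss rr; apply/eqP; rewrite eqn_leq !leq_num // => x; rewrite ?ss ?rr. Qed.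

Lemma num_shift i j A s r : i \notin s ++ r -> j \notin s ++ r ->
  num (shift i j A) s r = num A s r.
Proof.
rewrite !mem_cat !negb_or => /andP[is_ ir] /andP[js jr].
have fx (t : seq T) x : i \notin t -> j \notin t -> x \in t -> tperm i j x = x.
  by move=> it jt xt; rewrite tpermD //; [apply: contraNneq it | apply: contraNneq jt] => ->.
rewrite /num -(card_shift i j (sel A s r)); apply: eq_card => H.
rewrite in_sel !in_shift !in_sel.
have -> : all (fun x => x \in swap i j H) s = all (fun x => x \in H) s.
  by apply: eq_in_all => x xs; rewrite in_swap (fx s).
have -> : all (fun x => x \notin swap i j H) r = all (fun x => x \notin H) r.
  by apply: eq_in_all => x xs; rewrite in_swap (fx r).
case: (all _ s); case: (all _ r); rewrite /= ?andbT ?andbF //.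
all: by do !case: ifP.
Qed.

Lemma leq_num_shift i j A s r : j \in r -> num A s r <= num (shift i j A) s r.
Proof.
move=> jr; apply/subset_leq_card/subsetP=> F; rewrite !in_sel => /and3P[AF -> rF].
by rewrite rF !andbT; apply: in_shift_notin => //; apply: (allP rF).
Qed.

Lemma geq_num_shift i j A s r : j \in s -> num (shift i j A) s r <= num A s r.
Proof.
move=> js; apply/subset_leq_card/subsetP=> F; rewrite !in_sel => /and3P[AF sF ->].
by rewrite sF !andbT; apply: shift_in AF; apply: (allP sF).
Qed.

Definition link A (s r : seq T) : {set {set T}} :=
  [set F :\: [set:: s] | F in sel A s r].

Lemma card_link A s r : #|link A s r| = num A s r.
Proof.
apply: card_in_imset => F G; rewrite !in_sel => /and3P[_ /allP sF _] /and3P[_ /allP sG _] eFG.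
apply/setP=> x; have [xs | xs] := boolP (x \in s); first by rewrite sF ?sG.
by have /setP/(_ x) := eFG; rewrite !inE xs.
Qed.

(** * Shadows and the Kruskal-Katona theorem *)

Definition shadow_closed l A B :=
  forall F G, F \in A -> G \subset F -> #|G| = l -> G \in B.

(** Cases by which of [i], [j] lie in [H]. With both or neither, [H] is its own swap and an old
    member; with [j] alone, [H] and its swap are both old members. With [i] alone one of the two is,
    and since [j] is not in [G] it is enough that [G] or its swap lies in [B]. *)
Lemma shift_shadow_closed i j l A B :
  shadow_closed l A B -> shadow_closed l (shift i j A) (shift i j B).
Proof.
move=> cAB H G sH sGH cG; have sG := swapS i j sGH.
have cs : #|swap i j G| = l by rewrite card_swap.
have [iH|iH] := boolP (i \in H); have [jH|jH] := boolP (j \in H).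
- have eH : swap i j H = H by rewrite swap_id ?iH ?jH.
  have AH : H \in A by have := shift_sub sH; rewrite eH orbb.
  rewrite eH in sG; rewrite in_shift (cAB H G) // (cAB H (swap i j G)) //.
  by do !case: ifP.
- have jG : j \notin G by apply: contraNN jH; apply: (subsetP sGH).
  rewrite in_shift (negPf jG) andbT /=.
  have orG : (G \in B) || (swap i j G \in B).
    by case/orP: (shift_sub sH) => AH; rewrite ?(cAB _ _ AH sGH) ?(cAB _ _ AH sG) ?orbT.
  have [iG // | iG] := boolP (i \in G).
  by move: orG; rewrite swap_id ?orbb // (negPf iG) (negPf jG).
- have iG : i \notin G by apply: contraNN iH; apply: (subsetP sGH).
  have [AH AsH] : H \in A /\ swap i j H \in A.
    by apply/andP; move: sH; rewrite in_shift (negPf iH) jH.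
  rewrite in_shift (negPf iG) andbT /= (cAB H) //.
  by rewrite (cAB _ _ AsH) // if_same.
have eH : swap i j H = H by rewrite swap_id // (negPf iH) (negPf jH).
have AH : H \in A by have := shift_sub sH; rewrite eH orbb.
rewrite eH in sG; rewrite in_shift (cAB H G) // (cAB H (swap i j G)) //.
by do !case: ifP.
Qed.

Lemma in_link1 A v G : v \notin G -> (G \in link A [:: v] [::]) = (v |: G \in A).
Proof.
move=> vG; apply/imsetP/idP => [[F] | AG].
  rewrite in_sel /= !andbT => /andP[AF vF] ->; congr (_ \in A): AF.
  by apply/setP=> x; rewrite !inE; have [->|] := eqVneq x v.
exists (v |: G); first by rewrite in_sel /= AG setU11.
apply/setP=> x; rewrite !inE; have [->|//] := eqVneq x v; first exact/negbTE.
Qed.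

Lemma uniform_link a A s r : uniq s -> uniform a A -> uniform (a - size s) (link A s r).
Proof.
move=> us uA _ /imsetP[F + ->]; rewrite in_sel => /and3P[AF /allP sF _].
have -> : #|F :\: [set:: s]| = #|F| - #|[set:: s]|.
  rewrite cardsD; congr (_ - _); apply: eq_card => x; rewrite !inE.
  by apply/andP/idP => [[] // | xs]; rewrite sF.
by rewrite uA // cardsE; congr (_ - _); apply/card_uniqP.
Qed.

Lemma sel_uniform a A s r : uniform a A -> uniform a (sel A s r).
Proof. by move=> uA F; rewrite in_sel => /and3P[/uA]. Qed.

(* Frankl's proof: once shifted towards [v], the link of [v] contains the shadow of the members
   missing [v]. *)
Lemma kruskal_katona t r l A B : l <= r <= t -> uniform r A ->
  shadow_closed l A B -> 'C(t, r) <= #|A| -> 'C(t, l) <= #|B|.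
Proof.
elim: t r l A B => [|t IH] r l A B /andP[lr rt] uA clAB leA.
all: have [F AF] : exists F, F \in A by
  apply/set0Pn; rewrite -card_gt0; apply: leq_trans leA; rewrite bin_gt0.
all: have sub_bin : 'C(r, l) <= #|B| by
  rewrite -(uA F AF) -cards_draws; apply/subset_leq_card/subsetP=> G;
  rewrite inE => /andP[sGF /eqP cG]; apply: clAB AF sGF cG.
  by move: rt sub_bin; rewrite leqn0 => /eqP->.
move: rt; rewrite leq_eqVlt => /predU1P[er | rt]; first by rewrite -er.
move: lr; rewrite leq_eqVlt => /predU1P[el | lr].
  rewrite el; apply: leq_trans leA _; apply/subset_leq_card/subsetP=> G AG.
  by apply: (clAB G G AG) => //; rewrite uA // el.
case: l => [|l] in clAB lr sub_bin *; first by rewrite !bin0 in sub_bin *.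
case: r => // r in uA leA rt lr sub_bin *.
have [v vF] : exists v, v \in F by apply/set0Pn; rewrite -card_gt0 (uA F).
have dis : [disjoint [set v] & [set~ v]].
  by rewrite disjoints_subset; apply/subsetP=> x; rewrite !inE negbK.
pose Pr A' B' := [/\ uniform r.+1 A', shadow_closed l.+1 A' B',
  #|A'| = #|A| & #|B'| = #|B|].
have PrS i j A' B' : i \in [set v] -> j \in [set~ v] ->
    Pr A' B' -> Pr (shift i j A') (shift i j B').
  move=> _ _ [u c eA eB]; split; rewrite ?card_shift //.
    exact: shift_uniform.
  exact: shift_shadow_closed.
have [A' [B' [[u c eA eB] fA _]]] := compress dis PrS (And4 uA clAB erefl erefl).
rewrite -eA in leA; rewrite -eB {A B eA eB PrS Pr clAB uA AF sub_bin}.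
have splitA := num_split A' [::] [::] v.
have splitB := num_split B' [::] [::] v.
have selT (C : {set {set T}}) : sel C [::] [::] = C by apply/setP=> G; rewrite in_sel andbT.
rewrite {1}/num selT in splitA; rewrite {1}/num selT in splitB.
have uL : uniform r (link A' [:: v] [::]).
  by move=> G /(uniform_link _ u) -> //; rewrite subn1.
(* Otherwise Pascal's rule leaves at least C(t, r+1) members missing [v]. By induction their shadow
   on level [r] has at least C(t, r) sets, and fixedness under the shifts puts it into the link. *)
have leL : 'C(t, r) <= #|link A' [:: v] [::]|.
  rewrite leqNgt; apply/negP=> ltL.
  have : 'C(t, r) <= #|link A' [:: v] [::]|; last by rewrite leqNgt ltL.
  apply: (IH r.+1 r (sel A' [::] [:: v])); first by rewrite leqnSn.
  - exact: sel_uniform.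
  - move=> H G; rewrite in_sel /= andbT => /andP[AH vH] sGH cG.
    have [x xH xG] : exists2 x, x \in H & x \notin G.
      apply/subsetPn; apply/negP=> /subset_leq_card; rewrite (u H) // cG.
      by rewrite ltnn.
    have vG : v \notin G by apply: contraNN vH; apply: (subsetP sGH).
    rewrite in_link1 //.
    have xv : x != v by apply: contraNneq vH => <-.
    have := shift_fixed (fA v x _ _) AH xH vH; rewrite !inE => /(_ (eqxx _) xv).
    congr (_ \in A'); apply/esym/eqP; rewrite eqEcard card_swap (u H) //.
    rewrite cardsU1 vG cG leqnn andbT; apply/subsetP=> y; rewrite !inE.
    case/predU1P => [-> | yG]; first by rewrite tpermL.
    by rewrite tpermD ?(subsetP sGH) //; [apply: contraNneq vG | apply: contraNneq xG] => ->.
  - by move: leA; rewrite -/(num A' [::] [:: v]) binS splitA -card_link; lia.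
have vL H : H \in link A' [:: v] [::] -> v \notin H /\ v |: H \in A'.
  move=> LH; have vH : v \notin H by case/imsetP: LH => K _ ->; rewrite !inE eqxx.
  by rewrite -in_link1.
(* The same link serves twice: its shadow on level [l] gives members of [B] through [v], and on
   level [l.+1] members of [B] missing [v]. *)
rewrite binS addnC splitB -card_link; apply: leq_add.
  apply: IH uL _ leL; first lia.
  move=> H G /vL[vH AH] sGH cG.
  have vG : v \notin G by apply: contraNN vH; apply: (subsetP sGH).
  by rewrite in_link1 //; apply: c AH _ _; rewrite ?setUS ?cardsU1 ?vG ?cG.
apply: IH uL _ leL; first lia.
move=> H G /vL[vH AH] sGH cG.
have vG : v \notin G by apply: contraNN vH; apply: (subsetP sGH).
rewrite in_sel /= vG !andbT; apply: (c _ _ AH) cG.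
by apply: subset_trans sGH _; apply: subsetUr.
Qed.

(** * Cross-intersecting families *)

Definition within (Y : {set T}) A := {in A, forall F, F \subset Y}.

Lemma shift_within (Y : {set T}) i j A :
  i \in Y -> j \in Y -> within Y A -> within Y (shift i j A).
Proof.
move=> iY jY wA H /shift_sub/orP[/wA // | /wA/(swapS i j)].
by rewrite swapK (swap_id (F := Y)) ?iY ?jY.
Qed.

Lemma leq_card_within (Y : {set T}) a A :
  within Y A -> uniform a A -> #|A| <= 'C(#|Y|, a).
Proof.
move=> wA uA; rewrite -cards_draws; apply/subset_leq_card/subsetP=> F AF.
by rewrite inE wA ?uA /=.
Qed.

Lemma link_within A s r : within (~: [set:: s ++ r]) (link A s r).
Proof.
move=> _ /imsetP[F + ->]; rewrite in_sel => /and3P[_ _ /allP rF].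
apply/subsetP=> x; rewrite !inE mem_cat negb_or => /andP[-> xF] /=.
by apply: contraL xF => /rF.
Qed.

Lemma cross_link t A B s r z :
  cross t (sel A s (r ++ z)) (sel B r (s ++ z)) ->
  cross t (link A s (r ++ z)) (link B r (s ++ z)).
Proof.
move=> cAB _ _ /imsetP[F sF ->] /imsetP[G sG ->].
apply: leq_trans (cAB F G sF sG) _; apply/subset_leq_card/subsetP=> x.
move: sF sG; rewrite !in_sel !all_cat !inE.
move=> /and3P[_ _ /andP[/allP rF _]] /and3P[_ _ /andP[/allP sG _]].
move=> /andP[xF xG]; rewrite xF xG !andbT.
by apply/andP; split; [apply: contraL xG => /sG | apply: contraL xF => /rF].
Qed.

(** Complements in [Y] of members of [A] have size [#|Y| - a], and a [b]-set below such a complement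
    is disjoint from a member of [A], so it is not in [B]. Kruskal-Katona counts these excluded
    sets. *)
Lemma cross_kruskal_katona (Y : {set T}) t a b A B :
  within Y A -> within Y B -> uniform a A -> uniform b B -> cross 1 A B ->
  a + b <= #|Y| <= a + t -> 'C(t, #|Y| - a) <= #|A| ->
  #|B| + 'C(t, b) <= 'C(#|Y|, b).
Proof.
move=> wA wB uA uB cAB /andP[abY Yat] leA.
pose W := [set G : {set T} | G \subset Y & #|G| == b] :\: B.
have cW : #|W| + #|B| = 'C(#|Y|, b).
  rewrite -cards_draws -(cardsID B [set G : {set T} | G \subset Y & #|G| == b]) addnC.
  congr (_ + _); apply: eq_card => G; rewrite !inE.
  by have [BG | _] := boolP (G \in B); rewrite ?andbF // wB // uB // eqxx.
rewrite -cW addnC leq_add2r.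
have cS : #|[set Y :\: F | F in A]| = #|A|.
  have YDK F : F \in A -> Y :\: (Y :\: F) = F.
    by move/wA=> sF; rewrite setDDr setDv set0U; apply/setIidPr.
  by apply: card_in_imset => F G AF AG eFG; rewrite -(YDK F) // eFG YDK.
apply: (@kruskal_katona t (#|Y| - a) b [set Y :\: F | F in A]); rewrite ?cS //; first lia.
- by move=> _ /imsetP[F AF ->]; rewrite cardsD (setIidPr (wA F AF)) (uA F AF).
- move=> _ G /imsetP[F AF ->]; rewrite subsetD => /andP[sGY dGF] cG.
  rewrite !inE sGY cG eqxx !andbT; apply/negP=> BG.
  have := cAB F G AF BG; rewrite card_gt0 setIC => /negP; apply.
  by rewrite setI_eq0.
Qed.

(** Members of the two patterns can only meet outside [s], [r] and [z], so their links
    cross-intersect on the [m] remaining points. *)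
Lemma sel_kruskal_katona FF k s r z t :
  uniform k FF -> cross 1 FF FF -> uniq (s ++ r ++ z) ->
  let m := #|T| - size (s ++ r ++ z) in
  (k - size r) + (k - size s) <= m <= (k - size r) + t ->
  'C(t, m - (k - size r)) <= num FF r (s ++ z) ->
  num FF s (r ++ z) + 'C(t, k - size s) <= 'C(m, k - size s).
Proof.
move=> uF iF usrz m bnd leA.
have cY : #|~: [set:: s ++ r ++ z]| = m.
  by rewrite cardsCs setCK cardsE (card_uniqP usrz).
have [us ur] : uniq s /\ uniq r.
  by move: usrz; rewrite !cat_uniq => /and3P[-> _ /and3P[-> _ _]].
rewrite -card_link -cY; apply: (cross_kruskal_katona (a := k - size r) (A := link FF r (s ++ z))).
- have -> : [set:: s ++ r ++ z] = [set:: r ++ s ++ z].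
    by apply/setP=> x; rewrite !inE !mem_cat orbCA.
  exact: link_within.
- exact: link_within.
- by apply: uniform_link.
- by apply: uniform_link.
- apply: cross_link => F G; rewrite !in_sel => /and3P[FF1 _ _] /and3P[FF2 _ _].
  exact: iF.
- by rewrite cY.
- by rewrite cY card_link.
Qed.

(* Shift all elements of [Y] in place of [v].  Deleting [v] then keeps every pair of parts
   (members containing or missing [v]) cross [t]-intersecting, so if one part of [A] exceeds its
   bound, both parts of [B] satisfy theirs, and Pascal's rule applies. *)
Lemma cross_intersecting_bound t m (Y : {set T}) a b A B :
  0 < t -> #|Y| = m -> within Y A -> within Y B -> uniform a A -> uniform b B ->
  cross t A B -> a.*2 <= m + t -> b.*2 <= m + t ->
  #|A| <= 'C(m, m + t - a) \/ #|B| <= 'C(m, m + t - b).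
Proof.
move=> t0; elim: m Y a b A B => [|m IH] Y a b A B cY wA wB uA uB cAB la lb.
all: have [-> | [F AF]] := set_0Vmem A; first by left; rewrite cards0.
all: have [-> | [G BG]] := set_0Vmem B; first by right; rewrite cards0.
all: have tFG := cAB F G AF BG.
  move: tFG; have := wA F AF; rewrite (cards0_eq cY) subset0 => /eqP->.
  by rewrite set0I cards0 leqNgt t0.
have ta : t <= a by rewrite -(uA F AF); apply: leq_trans tFG (subset_leq_card (subsetIl _ _)).
have tb : t <= b by rewrite -(uB G BG); apply: leq_trans tFG (subset_leq_card (subsetIr _ _)).
(* At equality the claimed bound is the number of all [a]-subsets of [Y]. *)
move: la; rewrite leq_eqVlt => /predU1P[ea | la].
  left; have -> : m.+1 + t - a = a by lia.
  by rewrite -cY; apply: leq_card_within.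
move: lb; rewrite leq_eqVlt => /predU1P[eb | lb].
  right; have -> : m.+1 + t - b = b by lia.
  by rewrite -cY; apply: leq_card_within.
have [v vY] : exists v, v \in Y by apply/set0Pn; rewrite -card_gt0 cY.
have dis : [disjoint Y :\ v & [set v]].
  by rewrite disjoint_sym disjoints1 !inE eqxx.
pose Pr A' B' := [/\ within Y A' /\ within Y B', uniform a A' /\ uniform b B', cross t A' B',
  #|A'| = #|A| & #|B'| = #|B|].
have PrS i j A' B' : i \in Y :\ v -> j \in [set v] ->
    Pr A' B' -> Pr (shift i j A') (shift i j B').
  rewrite !inE => /andP[_ iY] /eqP-> [[wA' wB'] [uA' uB'] c eA eB].
  by split; rewrite ?card_shift //; [split; apply: shift_within | split; apply: shift_uniform
    | apply: shift_cross].
have PrAB : Pr A B by split.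
have [A' [B' [[[wA' wB'] [uA' uB'] c eA eB] fA fB]]] := compress dis PrS PrAB.
rewrite -eA -eB {tFG AF BG F G cAB wA wB uA uB PrS PrAB Pr eA eB A B}.
move: A' B' c wA' wB' uA' uB' fA fB => A B cAB wA wB uA uB fA _.
have cYv : #|Y :\ v| = m by have := cardsD1 v Y; rewrite vY cY => -[].
have selT (C : {set {set T}}) : sel C [::] [::] = C by apply/setP=> G; rewrite in_sel andbT.
have split1 (C : {set {set T}}) : #|C| = #|link C [:: v] [::]| + #|sel C [::] [:: v]|.
  by rewrite card_link -num_split /num selT.
have w0 (C : {set {set T}}) : within Y C -> within (Y :\ v) (sel C [::] [:: v]).
  move=> wC F; rewrite in_sel /= andbT subsetD1 => /andP[CF ->].
  by rewrite wC.
have w1 (C : {set {set T}}) : within Y C -> within (Y :\ v) (link C [:: v] [::]).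
  move=> wC _ /imsetP[F + ->]; rewrite in_sel => /andP[/wC sF _].
  by rewrite (_ : [set:: [:: v]] = [set v]) ?setSD //; apply/setP=> x; rewrite !inE.
have u0 (C : {set {set T}}) c : uniform c C -> uniform c (sel C [::] [:: v]) by apply: sel_uniform.
have u1 (C : {set {set T}}) c : uniform c C -> uniform (c - 1) (link C [:: v] [::]).
  exact: uniform_link.
have eD (F : {set T}) : F :\: [set:: [:: v]] = F :\ v by apply/setP=> x; rewrite !inE.
have c00 : cross t (sel A [::] [:: v]) (sel B [::] [:: v]).
  by move=> F G; rewrite !in_sel => /andP[AF _] /andP[BG _]; apply: cAB.
have c10 (C D : {set {set T}}) : cross t C D -> cross t (link C [:: v] [::]) (sel D [::] [:: v]).
  move=> cCD _ G /imsetP[F + ->]; rewrite !in_sel eD /= andbT.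
  move=> /andP[CF _]; rewrite andbT => /andP[DG vG].
  have -> : (F :\ v) :&: G = F :&: G.
    by apply/setP=> x; rewrite !inE; have [->|//] := eqVneq x v; rewrite (negPf vG) !andbF.
  exact: cCD.
(* If the links met in fewer than [t] points, [F] and [G] would meet in exactly [t], among them [v].
   The strict bounds on [a] and [b] then leave a point [x] of [Y] outside both, and trading [v] for
   [x] in [F] gives a member of [A] meeting [G] in too few points. *)
have c11 : cross t (link A [:: v] [::]) (link B [:: v] [::]).
  move=> _ _ /imsetP[F + ->] /imsetP[G + ->]; rewrite !in_sel !eD /= !andbT.
  move=> /andP[AF vF] /andP[BG vG]; rewrite leqNgt; apply/negP=> lt.
  have vFG : v \in F :&: G by rewrite inE vF.
  have eI : #|F :&: G| = #|(F :\ v) :&: (G :\ v)|.+1.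
    rewrite (cardsD1 v) vFG add1n; congr _.+1; apply: eq_card => x; rewrite !inE.
    by case: (x == v); rewrite //= andbF.
  have tFG := cAB F G AF BG.
  have cU := cardsUI F G; rewrite (uA F AF) (uB G BG) in cU.
  have [x xY xU] : exists2 x, x \in Y & x \notin F :|: G.
    by apply/subsetPn; apply/negP=> /subset_leq_card; rewrite cY; lia.
  rewrite inE negb_or in xU; case/andP: xU => xF xG.
  have xv : x != v by apply: contraNneq xF => ->.
  have := shift_fixed (fA x v _ _) AF vF xF; rewrite !inE xY xv eqxx => /(_ isT isT) AsF.
  have := cAB _ G AsF BG; apply/negP; rewrite -ltnNge.
  apply: leq_ltn_trans lt; apply/subset_leq_card/subsetP=> y; rewrite !inE => /andP[+ yG].
  rewrite yG !andbT; case: tpermP => [ey _ | _ xF' | _ /eqP yv yF].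
  - by rewrite ey (negPf xG) in yG.
  - by rewrite xF' in xF.
  - by rewrite yv yF.
have bound00 := IH _ a b _ _ cYv (w0 _ wA) (w0 _ wB) (u0 _ _ uA) (u0 _ _ uB) c00
  ltac:(lia) ltac:(lia).
have bound10 := IH _ _ b _ _ cYv (w1 _ wA) (w0 _ wB) (u1 _ _ uA) (u0 _ _ uB) (c10 _ _ cAB)
  ltac:(lia) ltac:(lia).
have bound01 := IH _ a _ _ _ cYv (w0 _ wA) (w1 _ wB) (u0 _ _ uA) (u1 _ _ uB)
  (cross_sym (c10 _ _ (cross_sym cAB))) ltac:(lia) ltac:(lia).
have bound11 := IH _ _ _ _ _ cYv (w1 _ wA) (w1 _ wB) (u1 _ _ uA) (u1 _ _ uB) c11
  ltac:(lia) ltac:(lia).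
have pascal c : t <= c -> c.*2 < m.+1 + t -> 'C(m.+1, m.+1 + t - c) =
    'C(m, m + t - c) + 'C(m, m + t - (c - 1)).
  move=> tc lc; have -> : m.+1 + t - c = (m + t - c).+1 by lia.
  have -> : m + t - (c - 1) = (m + t - c).+1 by lia.
  by rewrite binS addnC.
rewrite (split1 A) (split1 B) !pascal //.
by case: bound00; case: bound10; case: bound01; case: bound11; lia.
Qed.

(* Otherwise the common elements of [F] and [G] can be replaced in [F] by elements of [R]. *)
Lemma fixed_shift_card_gt A (R Q : {set T}) :
  cross 1 A A -> [disjoint R & Q] -> {in R & Q, forall i j, shift i j A = A} ->
  {in A &, forall F G, [disjoint R & F :|: G] -> F :&: G \subset Q -> #|R| < #|F :&: G|}.
Proof.
move=> iA dRQ fA; have [m] := ubnP #|R|.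
elim: m => // m IH in R dRQ fA * => leR F G AF AG dR sQ.
have [j jFG] : exists j, j \in F :&: G.
  by apply/set0Pn; rewrite -card_gt0; apply: iA.
have [-> | [i iR]] := set_0Vmem R; first by rewrite cards0 iA.
have cR := cardsD1 i R; rewrite iR in cR.
have cFG := cardsD1 j (F :&: G); rewrite jFG in cFG.
have := disjointFr dR iR; rewrite inE => /norP[iF iG].
have [jF jG] : j \in F /\ j \in G by move: jFG; rewrite inE => /andP[].
have AsF : swap i j F \in A by apply: shift_fixed AF jF iF; rewrite fA ?(subsetP sQ).
have ij : i != j by apply: contraNneq iF => ->.
have eI : swap i j F :&: G = (F :&: G) :\ j.
  apply/setP=> x; rewrite !inE; case: tpermP => [-> | -> | /eqP xi /eqP xj].
  - by rewrite (negPf iG) !andbF.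
  - by rewrite (negPf iF) eqxx.
  by rewrite xj.
rewrite cR cFG -eI !add1n ltnS; apply: IH => //.
- by apply: disjointWl dRQ; apply: subsetDl.
- by move=> i' j'; rewrite !inE => /andP[_ i'R] j'Q; apply: fA.
- by move: leR; rewrite cR; lia.
- rewrite disjoints_subset; apply/subsetP=> x; rewrite !inE => /andP[xi xR].
  have := disjointFr dR xR; rewrite inE => /norP[xF xG].
  rewrite (negPf xG) orbF; case: tpermP => [ex | ex | //]; first by rewrite ex eqxx in xi.
  by rewrite ex jF in xF.
- by rewrite eI; apply: subset_trans sQ; apply: subsetDl.
Qed.

Lemma exists_notin (s : seq T) : size s < #|T| -> exists x, x \notin s.
Proof.
move=> lt; apply/existsP; apply: contraLR lt; rewrite negb_exists -leqNgt => /forallP al.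
by apply: leq_trans (card_size s); apply/subset_leq_card/subsetP=> x _; apply/negPn.
Qed.

End Shift.

(** * Binomial estimates *)

Lemma leq_bin_add x y e : 'C(x, y) <= 'C(x + e, y + e).
Proof.
elim: e => [|e IH]; first by rewrite !addn0.
by rewrite !addnS binS; apply: leq_trans IH (leq_addl _ _).
Qed.

(** Pascal's rule applied [e] times, each loss being at most C(m-1, b-1). Writing the lower index as
    [m - b] gives the correct value 0 when [b = 0 < m]. *)
Lemma leq_bin_sub m b e : b + e <= m -> 'C(m, b) <= 'C(m - e, b) + e * 'C(m - 1, m - b).
Proof.
elim: e => [|e IH] le; first by rewrite subn0 addn0.
apply: leq_trans (IH _) _; first lia.
have -> : m - e = (m - e.+1).+1 by lia.
have -> : 'C((m - e.+1).+1, b) = 'C(m - e.+1, b) + 'C(m - e.+1, m - e - b).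
  case: b le {IH} => [|b] le; first by rewrite !bin0 bin_small //; lia.
  rewrite binS; congr (_ + _); rewrite -bin_sub; last lia.
  by congr 'C(_, _); lia.
rewrite mulSn addnA leq_add2r leq_add2l.
have := leq_bin_add (m - e.+1) (m - e - b) e.
by have -> : m - e.+1 + e = m - 1 by [lia]; have -> : m - e - b + e = m - b by [lia].
Qed.

Lemma leq_bin_left m i j : i <= j -> j.*2 <= m.+1 -> 'C(m, i) <= 'C(m, j).
Proof.
move=> /subnK <-; elim: (j - i) => // d IH le; apply: leq_trans (IH _) _; first lia.
rewrite addSn; have := mul_bin_left m (d + i).
have : (d + i).+1 <= m - (d + i) by lia.
nia.
Qed.

(** By symmetry the lower index on the left becomes [t.+1 + a - m], at most k-3. Pascal's rule
    splits C(t+1, k-3) into two terms of at most C(t, k-3), and C(t, k-2) is at least 8 times that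
    because [16 * k <= t]. *)
Lemma bin_gain k m a t : 16 * k <= t -> t < m - 3 -> m - a <= t -> a <= k -> 1 < k ->
  4 * 'C(t.+1, m - a) <= 'C(t, k - 2).
Proof.
move=> kt tm at_ ak k1.
have -> : 'C(t.+1, m - a) = 'C(t.+1, t.+1 + a - m).
  by rewrite -bin_sub; [congr 'C(_, _) |]; lia.
case: k => [|[|[|[|q]]]] in kt ak k1 *; do ?by lia.
have : 'C(t.+1, t.+1 + a - m) <= 'C(t.+1, q.+1) by apply: leq_bin_left; lia.
rewrite binS !subSS subn0.
have := mul_bin_left t q; have := mul_bin_left t q.+1.
have : 8 * q.+2 <= t - q.+1 by lia.
have : q.+1 <= t - q by lia.
nia.
Qed.

(** * Scattered families *)

Section Diversity.

Variables (T : finType) (k : nat).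
Hypotheses (k_gt1 : 1 < k) (n_gt : 48 * k < #|T|).
Implicit Types (A : {set {set T}}) (u v w x y i j p q : T) (s r z : seq T).

Local Notation n := #|T|.
Local Notation D := 'C(n - 3, n - k).
Local Notation M := 'C(n - 3, k - 2).

(** * Dense patterns force sparse ones *)

Definition int_fam A := uniform k A /\ cross 1 A A.

(** C(m-e, m-a) members of the second pattern would exclude C(m-e, b) sets from the first, leaving
    at most e C(m-1, b-1). If [a < e], a single member already excludes C(m-a, b). *)
Lemma sparse_of_dense A s r z e :
  int_fam A -> uniq (s ++ r ++ z) -> size (s ++ r ++ z) <= 3 ->
  let m := n - size (s ++ r ++ z) in
  let a := k - size r in let b := k - size s in
  e <= 3 -> e * 'C(m - 1, m - b) < num A s (r ++ z) ->
  num A r (s ++ z) = 0 \/ e <= a /\ num A r (s ++ z) < 'C(m - e, m - a).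
Proof.
move=> [uA iA] us sz m a b e3 dense.
have kk t : a + b <= m <= a + t -> 'C(t, m - a) <= num A r (s ++ z) ->
    num A s (r ++ z) + 'C(t, b) <= 'C(m, b).
  exact: (sel_kruskal_katona uA iA us).
have abm : a + b + 3 <= m by rewrite /a /b /m; lia.
have b0 := @leq_bin_sub m b; move: m a b {us sz} => m a b in dense kk abm b0 *.
have [ea | ae] := leqP e a.
  have [lt | ge] := ltnP (num A r (s ++ z)) 'C(m - e, m - a); first by right.
  have := kk (m - e) ltac:(lia) ge; have := b0 e ltac:(lia).
  lia.
left; apply/eqP; rewrite -leqn0 leqNgt; apply/negP=> ne.
have := kk (m - a) ltac:(lia); rewrite binn => /(_ ne).
have := b0 a ltac:(lia).
have : a * 'C(m - 1, m - b) <= e * 'C(m - 1, m - b) by rewrite leq_mul2r; lia.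
lia.
Qed.

Lemma avoid_pair_le A u v : int_fam A -> u != v ->
  3 * D < num A [:: u; v] [::] -> num A [::] [:: u; v] <= D.
Proof.
move=> fA uv dense.
have uq : uniq ([:: u; v] ++ [::] ++ [::]) by rewrite /= inE uv.
have := @sparse_of_dense A [:: u; v] [::] [::] 3 fA uq isT.
rewrite /= subn0.
have -> : n - 2 - 1 = n - 3 by lia.
have -> : n - 2 - (k - 2) = n - k by lia.
case=> // [->|[k3 /ltnW le]] //; apply: leq_trans le _.
have := leq_bin_add (n - 2 - 3) (n - 2 - k) 2.
by have -> : n - 2 - 3 + 2 = n - 3 by [lia]; have -> : n - 2 - k + 2 = n - k by [lia].
Qed.

Lemma avoid_link_le A u v w : int_fam A -> uniq [:: u; v; w] ->
  2 * D < num A [:: u; w] [:: v] -> num A [:: v] [:: u; w] <= D.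
Proof.
move=> fA uq dense.
have uq' : uniq ([:: u; w] ++ [:: v] ++ [::]).
  by move: uq; rewrite /= !inE !negb_or (eq_sym w) => /and3P[/andP[-> ->] -> _].
have := @sparse_of_dense A [:: u; w] [:: v] [::] 2 fA uq' isT; rewrite /=.
have leD : 'C(n - 3 - 1, n - 3 - (k - 2)) <= D.
  have := leq_bin_add (n - 3 - 1) (n - 3 - (k - 2)) 1.
  by have -> : n - 3 - 1 + 1 = n - 3 by [lia]; have -> : n - 3 - (k - 2) + 1 = n - k by [lia].
case=> // [|->|[k3 /ltnW le]] //; first by apply: leq_ltn_trans dense; rewrite leq_mul2l.
apply: leq_trans le _; have := leq_bin_add (n - 3 - 2) (n - 3 - (k - 1)) 2.
by have -> : n - 3 - 2 + 2 = n - 3 by [lia]; have -> : n - 3 - (k - 1) + 2 = n - k by [lia].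
Qed.

Lemma shift_int_fam i j A : int_fam A -> int_fam (shift i j A).
Proof. by case=> uA iA; split; [apply: shift_uniform | apply: shift_cross]. Qed.

(** Fixedness under shifts towards [x] makes members of the two patterns meet in 2 points. For
    [t = 2] and links of size [k - 1] on [n - 3] points, [cross_intersecting_bound] gives exactly
    [D]. *)
Lemma cross_two_bound A u v x : int_fam A -> uniq [:: u; v; x] ->
  {in [set x] & ~: [set:: [:: u; v; x]], forall i j, shift i j A = A} ->
  num A [:: u] [:: v; x] <= D \/ num A [:: v] [:: u; x] <= D.
Proof.
move=> [uA iA] uq fA.
have dis : [disjoint [set x] & ~: [set:: [:: u; v; x]]].
  by rewrite disjoints1 !inE eqxx !orbT.
have cAB : cross 2 (sel A [:: u] ([:: v] ++ [:: x])) (sel A [:: v] ([:: u] ++ [:: x])).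
  move=> F G; rewrite !in_sel /= !andbT => /and4P[AF uF vF xF] /and4P[AG vG uG xG].
  have := fixed_shift_card_gt iA dis fA AF AG; rewrite cards1; apply.
    by rewrite disjoints1 inE negb_or xF.
  apply/subsetP=> y; rewrite !inE => /andP[yF yG]; rewrite !negb_or.
  by apply/and3P; split; [apply: contraNneq uG | apply: contraNneq vF | apply: contraNneq xF] => <-.
have cY : #|~: [set:: [:: u; v; x]]| = n - 3 by rewrite cardsCs setCK cardsE (card_uniqP uq).
have w1 := @link_within T A [:: u] [:: v; x].
have w2 : within (~: [set:: [:: u; v; x]]) (link A [:: v] [:: u; x]).
  have -> : [set:: [:: u; v; x]] = [set:: [:: v; u; x]].
    by apply/setP=> y; rewrite !inE orbCA.
  exact: (@link_within T A [:: v] [:: u; x]).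
have u1 := @uniform_link T k A [:: u] [:: v; x] isT uA.
have u2 := @uniform_link T k A [:: v] [:: u; x] isT uA.
have := cross_intersecting_bound (isT : 0 < 2) cY w1 w2 u1 u2 (cross_link cAB).
rewrite /= !card_link; have -> : n - 3 + 2 - (k - 1) = n - k by lia.
have k2 : (k - 1).*2 <= n - 3 + 2 by lia.
exact.
Qed.

(** Two receiving points raise the meet to 3. With [t = 3] and sets of size [k] on [n - 3] points
    the bound is again [D]. *)
Lemma cross_three_bound A x p q : int_fam A -> uniq [:: x; p; q] ->
  {in [set p; q] & ~: [set:: [:: x; p; q]], forall i j, shift i j A = A} ->
  num A [::] [:: x; p; q] <= D.
Proof.
move=> [uA iA] uq fA.
have dis : [disjoint [set p; q] & ~: [set:: [:: x; p; q]]].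
  by rewrite disjoints_subset; apply/subsetP=> y; rewrite !inE => /orP[]->; rewrite ?orbT.
have cpq : #|[set p; q]| = 2.
  by rewrite cards2; move: uq; rewrite /= !inE => /and3P[_ -> _].
have cAB : cross 3 (sel A [::] ([::] ++ [:: x; p; q])) (sel A [::] ([::] ++ [:: x; p; q])).
  move=> F G; rewrite !in_sel /= !andbT => /and4P[AF xF pF qF] /and4P[AG xG pG qG].
  have := fixed_shift_card_gt iA dis fA AF AG; rewrite cpq; apply.
    rewrite disjoints_subset; apply/subsetP=> y; rewrite !inE => /orP[]/eqP->.
      by rewrite negb_or pF.
    by rewrite negb_or qF.
  apply/subsetP=> y; rewrite !inE => /andP[yF yG]; rewrite !negb_or.
  by apply/and3P; split; [apply: contraNneq xF | apply: contraNneq pF | apply: contraNneq qF] => <-.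
have cY : #|~: [set:: [:: x; p; q]]| = n - 3 by rewrite cardsCs setCK cardsE (card_uniqP uq).
have w1 := @link_within T A [::] [:: x; p; q].
have u1 := @uniform_link T k A [::] [:: x; p; q] isT uA.
have := cross_intersecting_bound (isT : 0 < 3) cY w1 w1 u1 u1 (cross_link cAB).
rewrite /= !card_link subn0; have -> : n - 3 + 3 - k = n - k by lia.
have k2 : k.*2 <= n - 3 + 3 by lia.
by case.
Qed.

(** * A third point for a pair *)

Lemma fresh s : size s < 48 -> exists x, x \notin s.
Proof.
move=> sz; apply: exists_notin; apply: leq_trans sz _.
by apply: leq_trans (ltnW n_gt); rewrite leq_pmulr // ltnW.
Qed.

Lemma mem_pairC (a b : T) : [:: a; b] =i [:: b; a].
Proof. by move=> x; rewrite !inE orbC. Qed.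

Lemma split_pair A s r x y :
  num A s r = num A (x :: s) r + num A (y :: s) (x :: r) + num A s (y :: x :: r).
Proof. by rewrite (num_split A s r x) (num_split A s (x :: r) y) addnA. Qed.

(** Split the members through [u] missing [v]. At most [2 * D] contain [x] and at most [2 * D]
    contain [j] but not [x], by [avoid_link_le] and the last hypothesis. Those missing both survive
    the shift, so a small count after it would leave at most [5 * D] in all. *)
Lemma avoid_shift_gt A u v x j : int_fam A -> uniq [:: u; v; x] ->
  j \notin [:: u; v; x] -> 5 * D < num A [:: u] [:: v] ->
  (forall w, w \notin [:: u; v] -> D < num A [:: v] [:: u; w]) ->
  D < num (shift x j A) [:: u] [:: v; x].
Proof.
move=> fA uq juvx big far; rewrite ltnNge; apply/negP=> small.
have small' : num A [:: u] [:: j; x; v] <= D.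
  apply: leq_trans small; apply: leq_trans (_ : num (shift x j A) [:: u] [:: j; x; v] <= _).
    by apply: leq_num_shift; rewrite inE eqxx.
  by apply: leq_num => // y; rewrite !inE => /orP[] ->; rewrite ?orbT.
have := split_pair A [:: u] [:: v] x j.
have : num A [:: j; u] [:: x; v] <= num A [:: j; u] [:: v].
  by apply: leq_num => // y; rewrite !inE => ->; rewrite orbT.
move: uq juvx; rewrite /= !inE !negb_or -!andbA => /and4P[uv ux vx _] /and3P[ju jv jx].
have dense w : w != u -> w != v -> num A [:: w; u] [:: v] <= 2 * D.
  move=> wu wv; rewrite leqNgt; apply/negP.
  rewrite (eq_num A (mem_pairC w u) (fun=> erefl)).
  have uq : uniq [:: u; v; w] by rewrite /= !inE negb_or uv (eq_sym u) wu (eq_sym v) wv.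
  move=> /(avoid_link_le fA uq); rewrite leqNgt far //.
  by rewrite !inE negb_or wu.
have := dense x; rewrite eq_sym ux eq_sym vx => /(_ isT isT).
have := dense j ju jv.
lia.
Qed.

(* If there is no such [w], shift outside [u], [v] towards a fixed [x]: by [avoid_shift_gt] there
   is never one, while [cross_two_bound] provides [w = x] at the end. *)
Lemma common_neighbour A u v : int_fam A -> u != v ->
  5 * D < num A [:: u] [:: v] -> 5 * D < num A [:: v] [:: u] ->
  exists2 w, uniq [:: u; v; w] & num A [:: u] [:: v; w] <= D /\ num A [:: v] [:: u; w] <= D.
Proof.
move=> fA uv bu bv.
pose sparse w := (num A [:: u] [:: v; w] <= D) || (num A [:: v] [:: u; w] <= D).
have [/existsP[w /andP[wuv sw]] | none] := boolP [exists w, (w \notin [:: u; v]) && sparse w].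
  have [wu wv] : w != u /\ w != v by apply/andP; move: wuv; rewrite !inE negb_or.
  have uq : uniq [:: u; v; w] by rewrite /= !inE negb_or uv (eq_sym u) wu (eq_sym v) wv.
  have uq' : uniq [:: v; u; w] by rewrite /= !inE negb_or eq_sym uv (eq_sym u) wu (eq_sym v) wv.
  exists w => //.
  (* The side that is at most [D] leaves more than [4 * D] members through [w] on that side, so
     [avoid_link_le] bounds the other side. *)
  case/orP: sw => le.
    split=> //; apply: (avoid_link_le fA uq).
    have := num_split A [:: u] [:: v] w.
    rewrite (eq_num A (mem_pairC w u) (fun=> erefl)).
    by rewrite (eq_num A (fun=> erefl) (mem_pairC w v)); lia.
  split=> //.
  apply: (avoid_link_le fA uq').
  have := num_split A [:: v] [:: u] w.
  rewrite (eq_num A (mem_pairC w v) (fun=> erefl)).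
  by rewrite (eq_num A (fun=> erefl) (mem_pairC w u)); lia.
have [x xuv] : exists x, x \notin [:: u; v] by apply: fresh.
have [xu xv] : x != u /\ x != v by apply/andP; move: xuv; rewrite !inE negb_or.
have uq : uniq [:: u; v; x] by rewrite /= !inE negb_or uv (eq_sym u) xu (eq_sym v) xv.
have uq' : uniq [:: v; u; x] by rewrite /= !inE negb_or eq_sym uv (eq_sym u) xu (eq_sym v) xv.
pose Pr (B C : {set {set T}}) := [/\ B = C, int_fam B,
  5 * D < num B [:: u] [:: v], 5 * D < num B [:: v] [:: u] &
  forall w, w \notin [:: u; v] -> D < num B [:: u] [:: v; w] /\ D < num B [:: v] [:: u; w]].
have PrA : Pr A A.
  split=> // w wuv; move: none; rewrite negb_exists => /forallP/(_ w).
  by rewrite wuv /= /sparse negb_or -!ltnNge => /andP.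
have dis : [disjoint [set x] & ~: [set:: [:: u; v; x]]].
  by rewrite disjoints1 !inE eqxx !orbT.
have PrS i j B C : i \in [set x] -> j \in ~: [set:: [:: u; v; x]] ->
    Pr B C -> Pr (shift i j B) (shift i j C).
  rewrite !inE => /eqP-> juvx [<- fB buB bvB far].
  have [ju jv jx] : [/\ j != u, j != v & j != x].
    by apply/and3P; move: juvx; rewrite !negb_or.
  have stay (a b : T) : a \in [:: u; v] -> b \in [:: u; v] -> x \notin [:: a] ++ [:: b] /\
      j \notin [:: a] ++ [:: b].
    by rewrite !inE => /orP[]/eqP-> /orP[]/eqP->; rewrite !negb_or ?xu ?xv ?ju ?jv.
  have mu : u \in [:: u; v] by rewrite !inE eqxx.
  have mv : v \in [:: u; v] by rewrite !inE eqxx orbT.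
  split; rewrite ?num_shift //; try by [case: (stay _ _ mu mv) | case: (stay _ _ mv mu)].
    exact: shift_int_fam.
  (* At [w = x] this is [avoid_shift_gt]; at [w = j] the counts can only grow; elsewhere they do not
     change. *)
  move=> w wuv; have [-> | wx] := eqVneq w x.
    split; [apply: avoid_shift_gt fB uq _ buB _ | apply: avoid_shift_gt fB uq' _ bvB _].
    - by rewrite !inE !negb_or ju jv.
    - by move=> y yuv; case: (far y yuv).
    - by rewrite !inE !negb_or ju jv.
    by move=> y; rewrite !inE orbC => yuv; case: (far y); rewrite ?inE.
  have [fu fv] := far w wuv.
  have [ewj | wj] := eqVneq w j.
    rewrite ewj in fu fv *.
    split; [apply: leq_trans fu _ | apply: leq_trans fv _];
      by apply: leq_num_shift; rewrite !inE eqxx orbT.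
  by rewrite !num_shift //= !inE !negb_or ?xu ?xv ?ju ?jv ?(eq_sym x w) ?(eq_sym j w) ?wx ?wj.
have [B [_ [[_ fB _ _ far] fix_ _]]] := compress dis PrS PrA.
have [fu fv] := far x xuv.
by case: (cross_two_bound fB uq fix_); rewrite leqNgt ?fu ?fv.
Qed.

(** * Impossibility of scattered families *)

Definition scattered A := [/\ int_fam A, 42 * D < #|A|,
  forall u v, u != v -> num A [:: u; v] [::] <= 4 * D &
  forall v, 14 * D < num A [::] [:: v]].

Lemma num_nil A : num A [::] [::] = #|A|.
Proof. by apply: eq_card => F; rewrite in_sel andbT. Qed.

(** If both counts were large, the third point [w] would leave at most [D] members through [u]
    missing [v] and [w], and the pair bound allows at most [4 * D] through [u] and [w]. *)
Lemma scattered_one_sided A u v : scattered A -> u != v ->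
  num A [:: u] [:: v] <= 5 * D \/ num A [:: v] [:: u] <= 5 * D.
Proof.
move=> [fA _ pairs _] uv.
have [le | bu] := leqP (num A [:: u] [:: v]) (5 * D); first by left.
have [le | bv] := leqP (num A [:: v] [:: u]) (5 * D); first by right.
have [w uq [le _]] := common_neighbour fA uv bu bv.
have wu : w != u.
  by move: uq; rewrite /= !inE negb_or => /andP[/andP[_ uw] _]; rewrite eq_sym.
have := num_split A [:: u] [:: v] w.
rewrite (eq_num A (fun=> erefl) (mem_pairC w v)).
have := pairs w u wu.
have : num A [:: w; u] [:: v] <= num A [:: w; u] [::] by apply: leq_num.
lia.
Qed.

(** Otherwise at most [D] members miss the pair, and by one-sidedness one of its points is missed by
    at most [5 * D + D] members. *)
Lemma scattered_pair A u v : scattered A -> u != v -> num A [:: u; v] [::] <= 3 * D.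
Proof.
move=> sA uv; rewrite leqNgt; apply/negP=> dense.
have [fA _ _ avoid] := sA.
have := avoid_pair_le fA uv dense.
have := num_split A [::] [:: v] u; have := num_split A [::] [:: u] v.
rewrite (eq_num A (fun=> erefl) (mem_pairC v u)).
have := avoid u; have := avoid v.
by case: (scattered_one_sided sA uv); lia.
Qed.

(** Orient each pair from [a] to [b] when at most [5 * D] members contain [a] and miss [b]. At least
    two of the three points have an outgoing arrow, and [key] applies to them. *)
Lemma scattered_triple A u v w : scattered A -> uniq [:: u; v; w] ->
  D < num A [::] [:: u; v; w].
Proof.
move=> sA; rewrite /= !inE negb_or => /and3P[/andP[uv uw] vw _].
rewrite ltnNge; apply/negP=> le; have [fA _ _ avoid] := sA.
(* Of the members missing [c], at most [3 * D] contain [a] and [b], [5 * D] only [a], [5 * D] only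
   [b], and [D] neither: [14 * D] in all. *)
have key (a b c : T) : a != b -> num A [:: a] [:: b; c] <= 5 * D ->
    num A [:: b] [:: a; c] <= 5 * D -> num A [::] [:: a; b; c] <= D -> False.
  move=> ab la lb labc.
  have := num_split A [::] [:: c] b; have := num_split A [:: b] [:: c] a.
  have := num_split A [::] [:: b; c] a.
  have := avoid c; have := scattered_pair sA ab.
  have : num A [:: a; b] [:: c] <= num A [:: a; b] [::] by apply: leq_num.
  lia.
have perm (a b c : T) : [:: a; b; c] =i [:: u; v; w] -> num A [::] [:: a; b; c] <= D.
  by move=> e; rewrite (eq_num A (fun=> erefl) e).
have fst (a b c : T) : num A [:: a] [:: b] <= 5 * D -> num A [:: a] [:: b; c] <= 5 * D.
  apply: leq_trans; apply: leq_num => // x.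
  by rewrite !inE => ->.
have snd (a b c : T) : num A [:: a] [:: c] <= 5 * D -> num A [:: a] [:: b; c] <= 5 * D.
  apply: leq_trans; apply: leq_num => // x.
  by rewrite !inE => ->; rewrite orbT.
have keyuv := key u v w uv; have keyuw := key u w v uw; have keyvw := key v w u vw.
have le1 := perm u w v; have le2 := perm v w u.
have {le1} le1 : num A [::] [:: u; w; v] <= D.
  by apply: le1 => x; rewrite !inE; congr (_ || _); apply: orbC.
have {le2} le2 : num A [::] [:: v; w; u] <= D.
  by apply: le2 => x; rewrite !inE [RHS]orbCA; congr (_ || _); apply: orbC.
have [suv | svu] := scattered_one_sided sA uv;
have [suw | swu] := scattered_one_sided sA uw;
have [svw | swv] := scattered_one_sided sA vw.
- by apply: keyuv => //; [apply: fst | apply: snd].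
- by apply: keyuw => //; [apply: fst | apply: snd].
- by apply: keyuw => //; [apply: snd | apply: fst].
- by apply: keyuw => //; [apply: snd | apply: fst].
- by apply: keyuv => //; [apply: snd | apply: fst].
- by apply: keyvw => //; [apply: snd | apply: fst].
- by apply: keyvw => //; [apply: fst | apply: snd].
- by apply: keyvw => //; [apply: snd | apply: snd].
Qed.

(** Only pairs through [i] can gain and only misses of [i] can drop. A dense pair [i], [v] leaves at
    most [D] new members missing it, hence at most [D] old ones missing [j], [i], [v], against
    [scattered_triple]. If [i] were missed by at most [14 * D] new members, at most that many old
    ones would miss [i] and [j], and one-sidedness adds only [5 * D] for one of the two points. *)
Lemma scattered_shift A i j : scattered A -> i != j ->
  19 * D < num A [::] [:: i] -> 19 * D < num A [::] [:: j] -> scattered (shift i j A).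
Proof.
move=> sA ij bi bj; have [fA cA pairs avoid] := sA.
have fS := shift_int_fam i j fA.
have ji : j != i by rewrite eq_sym.
have pairi v : v != i -> num (shift i j A) [:: i; v] [::] <= 4 * D.
  move=> vi; have [-> | vj] := eqVneq v j.
    by apply: leq_trans (pairs i j ij); apply: geq_num_shift; rewrite !inE eqxx orbT.
  rewrite leqNgt; apply/negP=> dense.
  have iv : i != v by rewrite eq_sym.
  have le : num (shift i j A) [::] [:: i; v] <= D by apply: (avoid_pair_le fS iv); lia.
  have uq : uniq [:: j; i; v] by rewrite /= !inE negb_or ji eq_sym vj iv.
  have := scattered_triple sA uq; rewrite ltnNge => /negP; apply; apply: leq_trans le.
  apply: leq_trans (_ : num (shift i j A) [::] [:: j; i; v] <= _).
    by apply: leq_num_shift; rewrite inE eqxx.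
  by apply: leq_num => // x; rewrite !inE => ->; rewrite orbT.
split=> //; first by rewrite card_shift.
  move=> u v uv; have [eu | ui] := eqVneq u i.
    by rewrite eu; apply: pairi; rewrite -eu eq_sym.
  have [ev | vi] := eqVneq v i.
    by rewrite ev (eq_num _ (mem_pairC u i) (fun=> erefl)); apply: pairi.
  apply: leq_trans (pairs u v uv).
  have [jm | jm] := boolP (j \in [:: u; v]); first exact: geq_num_shift.
  by rewrite num_shift // cats0 !inE negb_or (eq_sym i) ui (eq_sym i) vi.
move=> v; have [-> | vi] := eqVneq v i; last first.
  have [jm | jm] := eqVneq v j.
    by apply: leq_trans (avoid v) _; apply: leq_num_shift; rewrite jm inE eqxx.
  by rewrite num_shift //= inE eq_sym.
rewrite ltnNge; apply/negP=> le.
have leij : num A [::] [:: j; i] <= 14 * D.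
  apply: leq_trans le; apply: leq_trans (_ : num (shift i j A) [::] [:: j; i] <= _).
    by apply: leq_num_shift; rewrite inE eqxx.
  by apply: leq_num => // x; rewrite !inE => ->; rewrite orbT.
have := num_split A [::] [:: i] j; have := num_split A [::] [:: j] i.
rewrite (eq_num A (fun=> erefl) (mem_pairC i j)).
by case: (scattered_one_sided sA ij); lia.
Qed.

(** Two such points would give at most [(4 + 19 + 19) * D] members. *)
Lemma unique_center A x y : scattered A -> y != x ->
  num A [::] [:: x] <= 19 * D -> 19 * D < num A [::] [:: y].
Proof.
move=> [fA cA pairs _] yx cx; rewrite ltnNge; apply/negP=> cy.
rewrite -num_nil (num_split A [::] [::] x) (num_split A [:: x] [::] y) in cA.
have := pairs y x yx.
have : num A [:: x] [:: y] <= num A [::] [:: y] by apply: leq_num.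
lia.
Qed.

(** At the end of shifting towards [p] and [q], [cross_three_bound] contradicts [scattered_triple].
    No shift involves [x], so [Pr] can hold a condition on it. *)
Lemma scattered_compress A x (Pr : {set {set T}} -> Prop) : scattered A -> Pr A ->
  (forall B i j, i != x -> j != x -> i != j -> scattered B -> Pr B ->
    scattered (shift i j B) /\ Pr (shift i j B)) -> False.
Proof.
move=> sA PrA PrS.
have [p px] := fresh (isT : size [:: x] < 48).
have [q qpx] := fresh (isT : size [:: x; p] < 48).
have uq : uniq [:: x; p; q].
  move: px qpx; rewrite /= !inE !negb_or => px /andP[qx qp].
  by rewrite (eq_sym x) px (eq_sym x) qx eq_sym qp.
have dis : [disjoint [set p; q] & ~: [set:: [:: x; p; q]]].
  by rewrite disjoints_subset; apply/subsetP=> y; rewrite !inE => /orP[]->; rewrite ?orbT.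
pose P2 (B C : {set {set T}}) := [/\ B = C, scattered B & Pr B].
have PrS2 i j B C : i \in [set p; q] -> j \in ~: [set:: [:: x; p; q]] ->
    P2 B C -> P2 (shift i j B) (shift i j C).
  move=> ipq jn [<- sB PB].
  have ix : i != x.
    move: ipq uq; rewrite /= !inE negb_or.
    by case/orP=> /eqP-> /and3P[/andP[xp xq] _ _]; rewrite eq_sym.
  have ij : i != j by apply: contraTneq jn => <-; move: ipq; rewrite !inE negbK => ->; rewrite orbT.
  have jx : j != x by move: jn; rewrite !inE negb_or => /andP[].
  by have [sS PS] := PrS B i j ix jx ij sB PB.
have P2A : P2 A A by [].
have [B [_ [[_ sB _] fixB _]]] := compress dis PrS2 P2A.
have [fB _ _ _] := sB.
by have := scattered_triple sB uq; rewrite ltnNge (cross_three_bound fB uq fixB).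
Qed.

Lemma not_scattered A : ~ scattered A.
Proof.
have center B x : scattered B -> num B [::] [:: x] <= 19 * D -> False.
  move=> sB cx; apply: (scattered_compress (x := x)
    (Pr := fun C => num C [::] [:: x] <= 19 * D) sB cx) => C i j ix jx ij sC cC.
  split; last by rewrite num_shift //= inE.
  by apply: scattered_shift => //; apply: unique_center cC.
(* By [center] every point of a scattered family is missed by more than [19 * D] members, so no
   shift is blocked and any [x] serves. *)
move=> sA; have [x _] := fresh (isT : size ([::] : seq T) < 48).
apply: (scattered_compress (x := x) (Pr := fun=> True) sA I) => B i j _ _ ij sB _.
split=> //; apply: scattered_shift => //; rewrite ltnNge; apply/negP; exact: center.
Qed.

(** * Dense pairs and the final count *)

Lemma leq_bound47 : 47 * D <= M.
Proof.
have eM : M = 'C(n - 3, n - k - 1) by rewrite -bin_sub; [congr 'C(_, _) |]; lia.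
(* This is (n-k) D = (k-2) M, and n-k is at least 47k. *)
have := mul_bin_left (n - 3) (n - k - 1); rewrite -eM.
have -> : (n - k - 1).+1 = n - k by lia.
have -> : n - 3 - (n - k - 1) = k - 2 by lia.
move=> eD; rewrite -(@leq_pmul2l k) ?(ltnW k_gt1) // mulnA.
have le1 : k * 47 * D <= (n - k) * D by rewrite leq_mul2r; apply/orP; right; lia.
apply: leq_trans le1 _; rewrite eD leq_mul2r; apply/orP; right; lia.
Qed.

Lemma bound_gt0 : 0 < M.
Proof. by rewrite bin_gt0; lia. Qed.

(** Bracket the second count between consecutive binomials with upper indices [t] and [t.+1].
    Kruskal-Katona makes the deficit at least C(t, k-2), which by [bin_gain] is four times the upper
    bracket. The preliminary bound with [e = 3] keeps [t] in the range of [bin_gain]. *)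
Lemma deficit_dominates A u v r z : int_fam A -> uniq ([:: u; v] ++ r ++ z) ->
  size r + size z = 1 -> M <= num A [:: u; v] (r ++ z) + 3 * D ->
  num A [:: u; v] (r ++ z) + 4 * num A r ([:: u; v] ++ z) <= M.
Proof.
move=> fA uq rz dense.
have sz : size ([:: u; v] ++ r ++ z) = 3 by rewrite !size_cat rz.
have h47 := leq_bound47; have M0 := bound_gt0.
have leD : 'C(n - 3 - 1, n - 3 - (k - 2)) <= D.
  have := leq_bin_add (n - 3 - 1) (n - 3 - (k - 2)) 1.
  by have -> : n - 3 - 1 + 1 = n - 3 by [lia]; have -> : n - 3 - (k - 2) + 1 = n - k by [lia].
have [uA iA] := fA.
have kk t : (k - size r) + (k - 2) <= n - 3 <= (k - size r) + t ->
    'C(t, n - 3 - (k - size r)) <= num A r ([:: u; v] ++ z) ->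
    num A [:: u; v] (r ++ z) + 'C(t, k - 2) <= M.
  by have := sel_kruskal_katona (t := t) uA iA uq; rewrite sz.
have := sparse_of_dense (e := 3) fA uq; rewrite sz => /(_ isT isT) sp.
have leM : num A [:: u; v] (r ++ z) <= M.
  have -> : M = 'C(#|~: [set:: [:: u; v] ++ r ++ z]|, k - 2).
    by rewrite cardsCs setCK cardsE (card_uniqP uq) sz.
  rewrite -card_link; apply: leq_card_within; first exact: link_within.
  by apply: uniform_link => //; move: uq; rewrite cat_uniq => /andP[].
(* [M0] provides strictness when [D = 0], as for [k = 2]. *)
case: sp => [|->|[k3 lt]]; first by
    apply: leq_ltn_trans (_ : 3 * D < _); [rewrite leq_mul2l | lia].
  by rewrite muln0 addn0.
case: (posnP (num A r ([:: u; v] ++ z))) => [-> | pos]; first by rewrite muln0 addn0.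
have ex : exists t, num A r ([:: u; v] ++ z) < 'C(t, n - 3 - (k - size r)).
  by exists (n - 3 - 3).
have [t ltt mint] := ex_minnP ex.
have let_ := mint _ lt.
have gt_ : n - 3 - (k - size r) < t.
  rewrite ltnNge; apply/negP; rewrite leq_eqVlt => /predU1P[et | lt'].
    by move: ltt; rewrite et binn ltnNge pos.
  by move: ltt; rewrite bin_small.
case: t => [//|t] in ltt mint let_ gt_ *.
have ge : 'C(t, n - 3 - (k - size r)) <= num A r ([:: u; v] ++ z).
  by rewrite leqNgt; apply/negP=> /mint; rewrite ltnn.
have := kk t ltac:(lia) ge.
have := @bin_gain k (n - 3) (k - size r) t ltac:(lia) ltac:(lia) ltac:(lia) ltac:(lia) k_gt1.
lia.
Qed.

Lemma int_fam_diversity A : int_fam A -> (forall x, M < num A [::] [:: x]) -> False.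
Proof.
move=> fA big; have h47 := leq_bound47; have M0 := bound_gt0.
apply: (@not_scattered A); split=> //.
- have [x _] := fresh (isT : size ([::] : seq T) < 48).
  have : num A [::] [:: x] <= #|A| by rewrite -num_nil; apply: leq_num.
  by have := big x; lia.
- move=> u v uv; rewrite leqNgt; apply/negP=> dense.
  have le0 : num A [::] [:: u; v] <= D by apply: (avoid_pair_le fA uv); lia.
  have bu : 5 * D < num A [:: u] [:: v].
    by have := num_split A [::] [:: v] u; have := big v; lia.
  have bv : 5 * D < num A [:: v] [:: u].
    have := num_split A [::] [:: u] v; have := big u.
    by rewrite (eq_num A (fun=> erefl) (mem_pairC v u)); lia.
  have [w uq [lu lv]] := common_neighbour fA uv bu bv.
  move: uq; rewrite /= !inE negb_or => /and3P[/andP[_ uw] vw _].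
  have swap2 (a b c : T) : num A [:: a] [:: b; c] = num A [:: a] [:: c; b].
    exact: eq_num (fun=> erefl) (mem_pairC b c).
  have rot1 : num A [::] [:: u; w; v] = num A [::] [:: u; v; w].
    by apply: eq_num => // x; rewrite !inE; congr (_ || _); apply: orbC.
  have rot2 : num A [::] [:: v; w; u] = num A [::] [:: u; v; w].
    by apply: eq_num => // x; rewrite !inE [RHS]orbCA; congr (_ || _); apply: orbC.
  have splitw := num_split A [::] [:: w] v; rewrite (num_split A [:: v] [:: w] u) in splitw.
  rewrite (num_split A [::] [:: v; w] u) in splitw.
  have splitv := num_split A [::] [:: v] w; rewrite (num_split A [:: w] [:: v] u) in splitv.
  rewrite (num_split A [::] [:: w; v] u) rot1 (swap2 u) in splitv.
  have splitu := num_split A [::] [:: u] w; rewrite (num_split A [:: w] [:: u] v) in splitu.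
  rewrite (num_split A [::] [:: w; u] v) rot2 (swap2 v) (swap2 w) in splitu.
  have le1 : num A [::] [:: u; v; w] <= num A [::] [:: u; v].
    by apply: leq_num => // x; rewrite !inE => /orP[]->; rewrite ?orbT.
  have bigu := big u; have bigv := big v; have bigw := big w.
  have quvw : uniq [:: u; v; w] by rewrite /= !inE negb_or uv uw vw.
  have quwv : uniq [:: u; w; v] by rewrite /= !inE negb_or uv uw eq_sym vw.
  have qvwu : uniq [:: v; w; u].
    by rewrite /= !inE negb_or vw (eq_sym v) uv (eq_sym w) uw.
  have dd (a b c : T) : uniq [:: a; b; c] -> M <= num A [:: a; b] [:: c] + 3 * D ->
      num A [:: a; b] [:: c] + 4 * num A [:: c] [:: a; b] <= M /\
      num A [:: a; b] [:: c] + 4 * num A [::] [:: a; b; c] <= M.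
    move=> q le; split; first exact: (@deficit_dominates A a b [:: c] [::]).
    exact: (@deficit_dominates A a b [::] [:: c]).
  (* At most [D] members each meet the triple in [u] alone, in [v] alone, or not at all, so the pair
     [u], [v] has deficit below [3 * D]. Then [dw] bounds those with [w] alone, which gives the
     other two deficits. *)
  have [dw dw0] := dd u v w quvw ltac:(lia).
  have [dv dv0] := dd u w v quwv ltac:(lia).
  have [du du0] := dd v w u qvwu ltac:(lia).
  (* In the sum of the three avoidance counts each one-point class occurs twice and the class
     missing the triple three times. By the quarter bounds they amount to at most three quarters of
     the total deficit, while exceeding [3 * M] needs more than all of it. *)
  rewrite rot1 in dv0; rewrite rot2 in du0.
  lia.
by move=> v; have := big v; lia.
Qed.

End Diversity.

(** * The minimum over points and the theorem *)

Lemma bigminn_le (I : Type) (s : seq I) (f : I -> nat) m :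
  \big[minn/m]_(i <- s) f i <= m.
Proof. by elim/big_rec: _ => // i x _; apply: leq_trans (geq_minr _ _). Qed.

Lemma bigminn_inf (I : eqType) (s : seq I) (f : I -> nat) m i :
  i \in s -> \big[minn/m]_(j <- s) f j <= f i.
Proof.
elim: s => // j s IH; rewrite big_cons inE => /predU1P[-> | /IH]; first exact: geq_minl.
exact: leq_trans (geq_minr _ _).
Qed.

Theorem mainTheorem1 (n k : nat) (FF : {set {set 'I_n}}) :
  0 < n -> 0 < k -> 48 * k < n ->
  k_uniform k FF -> intersecting FF ->
  diversity FF <= binom_sub2 (n - 3) k.
Proof.
move=> n0 k0 kn /forall_inP uF /forall_inP iF.
have uFF : uniform k FF by move=> F /uF/eqP.
have iFF : cross 1 FF FF.
  by move=> F G FF1 GF; rewrite card_gt0; have /forall_inP := iF F FF1; apply.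
have le_avoid i : diversity FF <= #|avoid FF i|.
  by apply: bigminn_inf; apply: mem_index_enum.
rewrite /binom_sub2; case: ltnP => [k1 | k2].
  (* For [k = 1] the bound is 0: a member is a singleton [[set i]], so no member misses [i]. *)
  have [F0 | [F FF1]] := set_0Vmem FF.
    by apply: leq_trans (bigminn_le _ _ _) _; rewrite F0 cards0.
  have [i eF] : exists i, F = [set i].
    by apply/cards1P; rewrite (uFF F FF1) eqn_leq k0 -ltnS k1.
  apply: leq_trans (le_avoid i) _; rewrite leqn0 cards_eq0; apply/eqP/setP=> G.
  rewrite !inE; apply/negP=> /andP[GF iG].
  by have := iFF F G FF1 GF; rewrite eF card_gt0 setI_eq0 disjoints1 iG.
rewrite leqNgt; apply/negP=> gt.
apply: (@int_fam_diversity 'I_n k k2 _ FF); rewrite ?card_ord //.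
move=> i; apply: leq_trans gt _; apply: leq_trans (le_avoid i) _.
apply/subset_leq_card/subsetP=> F; rewrite in_sel inE => /andP[-> iF'] /=.
by rewrite iF'.
Qed.
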